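(* The semigroup $s\mathcal{R}(\mathfrak{S}_n)=\mathcal{R}(\mathfrak{S}_n)\setminus\mathfrak{S}_n$ is presented (as a semigroup) by generators $e_{i,j}$ and $z^r_{i,j}$ ($r\in[n-1]$, $i,j\in[n]$, $i<j$) subject to the relations: (a) $e_{i,j}^2=e_{i,j}$, $e_{i,j}e_{r,s}=e_{r,s}e_{i,j}$, and $e_{i,j}e_{i,k}=e_{i,j}e_{j,k}=e_{i,k}e_{j,k}$ for $i<j<k$; (b) $z^r_{i,j}z^t_{r(i),r(j)}z^r_{(t\circ r)(i),(t\circ r)(j)}=z^t_{i,j}z^r_{t(i),t(j)}z^t_{(r\circ t)(i),(r\circ t)(j)}$ for $|r-t|=1$; (c) $z^r_{i,j}z^t_{r(i),r(j)}=z^t_{i,j}z^r_{t(i),t(j)}$ for $|r-t|>1$; (d) $z^r_{i,j}z^r_{h,k}=e_{i,j}e_{r(h),r(k)}$, $e_{i,j}z^r_{i,j}=z^r_{i,j}$, and $z^r_{i,j}e_{h,k}=e_{r(h),r(k)}z^r_{i,j}$.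
   Context: $\mathfrak{C}_n$ is the partition monoid (set partitions of $[2n]$, top points $1..n$, bottom $n+1..2n$, concatenation product $*$). $I\preceq J$ means each block of $J$ is a union of blocks of $I$. $\mathfrak{S}_n\subseteq\mathfrak{C}_n$ consists of partitions with all blocks $\{i,n+j\}$; $s_r$ are the simple transpositions; $1=\{\{i,n+i\}\}$. $\mathcal{R}(\mathfrak{S}_n)$ is the monoid of pairs $(I,J)$ of set partitions of $[2n]$ with $I\in\mathfrak{S}_n$, $I\preceq J$, product $(I,J)(H,K)=(I*H,J*K)$; $\mathfrak{S}_n$ is identified with $\{(w,w)\}$. For $i<j$, $e_{i,j}=(1,J_{i,j})$ where $J_{i,j}$ merges the blocks $\{i,n+i\}$ and $\{j,n+j\}$ of $1$, and $z^r_{i,j}=e_{i,j}s_r$. Notation: $r(i)$ denotes the image of $i$ under $s_r$, and $(t\circ r)(i)$ denotes the image of $i$ under the permutation $s_ts_r$; indices written in decreasing order are read in increasing order ($e_{a,b}=e_{b,a}$, $z^r_{a,b}=z^r_{b,a}$). *)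

(* Defs.v *)
From mathcomp Require Import all_boot all_order all_fingroup.
Set Implicit Arguments. Unset Strict Implicit. Unset Printing Implicit Defensive.

Section PartitionMonoid.
Variable n : nat.

(* The 2n points: top point i is [lshift n i], bottom point n+j is [rshift n j]. *)
Definition pt := 'I_(n + n).
Definition setpart := {set {set pt}}.

Definition same_block (P : setpart) (x y : pt) : bool :=
  [exists B in P, (x \in B) && (y \in B)].

(* Vertices of the concatenation diagram: outer points (top of the first
   factor, bottom of the second) and the n middle points. *)
Definition cvert := (pt + 'I_n)%type.

Definition ptI (u : cvert) : option pt :=
  match u with
  | inl p => match split p with inl i => Some (lshift n i) | inr _ => None end
  | inr m => Some (rshift n m)
  end.

Definition ptJ (u : cvert) : option pt :=
  match u with
  | inl p => match split p with inl _ => None | inr j => Some (rshift n j) end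
  | inr m => Some (lshift n m)
  end.

Definition orel (P : setpart) (a b : option pt) : bool :=
  match a, b with Some x, Some y => same_block P x y | _, _ => false end.

Definition cedge (I J : setpart) : rel cvert :=
  fun u v => orel I (ptI u) (ptI v) || orel J (ptJ u) (ptJ v).

Definition pconcat (I J : setpart) : setpart :=
  [set [set q : pt | connect (cedge I J) (inl p) (inl q)] | p : pt].

Definition perm_part (w : 'S_n) : setpart :=
  [set [set lshift n i; rshift n (w i)] | i : 'I_n].

Definition refines (I J : setpart) : Prop :=
  forall B, B \in J -> exists S : {set {set pt}}, S \subset I /\ cover S = B.

Definition relt := (setpart * setpart)%type.

Definition in_R (x : relt) : Prop :=
  (exists w : 'S_n, x.1 = perm_part w) /\ partition x.2 [set: pt] /\ refines x.1 x.2.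

(* S_n is identified with {(w,w)}; sR(S_n) = R(S_n) \ S_n *)
Definition in_sR (x : relt) : Prop := in_R x /\ x.1 <> x.2.

Definition rmul (x y : relt) : relt := (pconcat x.1 y.1, pconcat x.2 y.2).

(* simple transposition s_r (0-indexed: swaps r and r+1), r.+1 < n *)
Definition sr (r : 'I_n) : 'S_n := tperm r (insubd r r.+1).

Definition s_elt (r : 'I_n) : relt := (perm_part (sr r), perm_part (sr r)).

Definition Jmerge (i j : 'I_n) : setpart :=
  [set B in perm_part 1 | (lshift n i \notin B) && (lshift n j \notin B)]
  :|: [set [set lshift n i; rshift n i; lshift n j; rshift n j]].

Definition e_elt (i j : 'I_n) : relt := (perm_part 1, Jmerge i j).
Definition z_elt (r i j : 'I_n) : relt := rmul (e_elt i j) (s_elt r).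

Inductive gen := GE of 'I_n & 'I_n | GZ of 'I_n & 'I_n & 'I_n.

Definition valid_gen (g : gen) : bool :=
  match g with
  | GE i j => i < j
  | GZ r i j => (r.+1 < n) && (i < j)
  end.

Definition gval (g : gen) : relt :=
  match g with GE i j => e_elt i j | GZ r i j => z_elt r i j end.

(* evaluation of a nonempty word (empty word evaluates to a dummy value) *)
Definition evalw (w : seq gen) : relt :=
  match w with
  | [::] => (perm_part 1, perm_part 1)
  | g :: w' => foldl (fun x h => rmul x (gval h)) (gval g) w'
  end.

(* index convention e_{a,b} = e_{b,a}, z^r_{a,b} = z^r_{b,a} *)
Definition oming (a b : 'I_n) : 'I_n := if a < b then a else b.
Definition omaxg (a b : 'I_n) : 'I_n := if a < b then b else a.
Definition E (a b : 'I_n) : gen := GE (oming a b) (omaxg a b).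
Definition Z (r a b : 'I_n) : gen := GZ r (oming a b) (omaxg a b).

Definition dist (r t : 'I_n) : nat := (r - t) + (t - r).

Definition relax (u v : seq gen) : Prop :=
  (exists i j : 'I_n, i < j /\ u = [:: E i j; E i j] /\ v = [:: E i j])
  \/ (exists i j r s : 'I_n, i < j /\ r < s /\
        u = [:: E i j; E r s] /\ v = [:: E r s; E i j])
  \/ (exists i j k : 'I_n, i < j < k /\
        u = [:: E i j; E i k] /\ v = [:: E i j; E j k])
  \/ (exists i j k : 'I_n, i < j < k /\
        u = [:: E i j; E j k] /\ v = [:: E i k; E j k])
  \/ (exists r t i j : 'I_n, r.+1 < n /\ t.+1 < n /\ dist r t = 1 /\ i < j /\
        u = [:: Z r i j; Z t (sr r i) (sr r j);
                Z r (sr t (sr r i)) (sr t (sr r j))] /\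
        v = [:: Z t i j; Z r (sr t i) (sr t j);
                Z t (sr r (sr t i)) (sr r (sr t j))])
  \/ (exists r t i j : 'I_n, r.+1 < n /\ t.+1 < n /\ 1 < dist r t /\ i < j /\
        u = [:: Z r i j; Z t (sr r i) (sr r j)] /\
        v = [:: Z t i j; Z r (sr t i) (sr t j)])
  \/ (exists r i j h k : 'I_n, r.+1 < n /\ i < j /\ h < k /\
        u = [:: Z r i j; Z r h k] /\ v = [:: E i j; E (sr r h) (sr r k)])
  \/ (exists r i j : 'I_n, r.+1 < n /\ i < j /\
        u = [:: E i j; Z r i j] /\ v = [:: Z r i j])
  \/ (exists r i j h k : 'I_n, r.+1 < n /\ i < j /\ h < k /\
        u = [:: Z r i j; E h k] /\ v = [:: E (sr r h) (sr r k); Z r i j]).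

Inductive wcong : seq gen -> seq gen -> Prop :=
  | wc_refl w : wcong w w
  | wc_sym u v : wcong u v -> wcong v u
  | wc_trans u v w : wcong u v -> wcong v w -> wcong u w
  | wc_ctx a b l r : all valid_gen a -> all valid_gen b -> relax l r ->
      wcong (a ++ l ++ b) (a ++ r ++ b).

End PartitionMonoid.

(* Main.v *)
Require Import Defs.
From mathcomp Require Import all_boot all_order all_fingroup zify.
Set Implicit Arguments. Unset Strict Implicit. Unset Printing Implicit Defensive.

(** A pair (I, J) of R(S_n) is a permutation w together with an equivalence relation
    on the n top points, and words in the generators act on such data: the permutations
    multiply, and the pair {i, j} carried by each letter, pulled back to the top row,
    is merged. Conversely, if the first letter of a word carries {i, j}, the relations
    rewrite the word as a product of e's times a chain
    [z^{r1}_{i,j} z^{r2}_{r1(i),r1(j)} ...]. On chains the relations (b), (c), (d) become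
    the Coxeter relations of S_n, so a chain depends only on its permutation once {i, j}
    is fixed; in the presence of e_{i,j} e_{h,k} the pair {i, j} may be replaced by
    {h, k}; and by (a) a product of e's depends only on the equivalence relation it
    generates. *)

(** * The Coxeter presentation of the symmetric group *)

(** Acting on all naturals rather than on ordinals lets the induction on the rank proceed without a
    change of type. *)
Definition adj_swap (r x : nat) : nat :=
  if x == r then r.+1 else if x == r.+1 then r else x.

(* Innermost tests first, so that no conditional survives in a hypothesis. *)
Ltac swap_lia := rewrite /adj_swap;
  repeat match goal with
    |- context [?a == ?b] =>
      lazymatch a with
        context [if _ then _ else _] => fail | _ => case: (@eqP _ a b) => ?
      end
  end; lia.

Definition act_word (u : seq nat) (x : nat) : nat :=
  foldl (fun y r => adj_swap r y) x u.

Lemma adj_swapK r : involutive (adj_swap r).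
Proof. by move=> x; swap_lia. Qed.

Lemma act_word_cat u v x : act_word (u ++ v) x = act_word v (act_word u x).
Proof. exact: foldl_cat. Qed.

Lemma act_word_revK u : cancel (act_word u) (act_word (rev u)).
Proof.
elim: u => //= r u IHu x.
by rewrite rev_cons -cats1 act_word_cat /= IHu adj_swapK.
Qed.

Lemma act_word_inj u : injective (act_word u).
Proof. exact: can_inj (act_word_revK u). Qed.

Lemma act_word_gt m u x : all (fun r => r < m) u -> m < x -> act_word u x = x.
Proof.
elim: u x => //= r u IHu x /andP[ltrm um] ltmx.
have -> : adj_swap r x = x by swap_lia.
exact: IHu.
Qed.

Inductive cox_rel : seq nat -> seq nat -> Prop :=
  | cox_sq r : cox_rel [:: r; r] [::]
  | cox_braid r : cox_rel [:: r; r.+1; r] [:: r.+1; r; r.+1]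
  | cox_far r t : r.+1 < t -> cox_rel [:: r; t] [:: t; r].

(* The letters of every intermediate word stay below [m]. *)
Inductive cox (m : nat) : seq nat -> seq nat -> Prop :=
  | cox_refl u : cox m u u
  | cox_sym u v : cox m u v -> cox m v u
  | cox_trans u v w : cox m u v -> cox m v w -> cox m u w
  | cox_step a b l r : all (fun x => x < m) a -> all (fun x => x < m) b ->
      all (fun x => x < m) (l ++ r) -> cox_rel l r ->
      cox m (a ++ l ++ b) (a ++ r ++ b).

Lemma cox_cat m a b u v : all (fun x => x < m) a -> all (fun x => x < m) b ->
  cox m u v -> cox m (a ++ u ++ b) (a ++ v ++ b).
Proof.
move=> am bm; elim=> [w|w w' _|w w' w'' _ IH _|c d l r cm dm lrm lr].
- exact: cox_refl.
- exact: cox_sym.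
- exact: cox_trans IH.
- rewrite -!catA ![a ++ (c ++ _)]catA.
  by apply: cox_step lr => //; rewrite all_cat ?am ?cm ?dm ?bm.
Qed.

Lemma cox_catl m a u v : all (fun x => x < m) a ->
  cox m u v -> cox m (a ++ u) (a ++ v).
Proof. by move=> am /(@cox_cat m a [::]); rewrite !cats0; apply. Qed.

Lemma cox_catr m b u v : all (fun x => x < m) b ->
  cox m u v -> cox m (u ++ b) (v ++ b).
Proof. by move=> bm /(@cox_cat m [::] b); apply. Qed.

Lemma cox_rel_cox m l r : all (fun x => x < m) (l ++ r) -> cox_rel l r -> cox m l r.
Proof. by move=> lrm /(@cox_step m [::] [::] _ _ isT isT lrm); rewrite !cats0. Qed.

Lemma cox_widen m m' u v : m <= m' -> cox m u v -> cox m' u v.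
Proof.
move=> lemm'.
have wid s : all (fun x => x < m) s -> all (fun x => x < m') s.
  by apply: sub_all => x /leq_trans; apply.
elim=> [w|w w' _|w w' w'' _ IH _|a b l r /wid am /wid bm /wid lrm lr].
- exact: cox_refl.
- exact: cox_sym.
- exact: cox_trans IH.
- exact: cox_step lr.
Qed.

Lemma cox_act m u v : cox m u v -> act_word u =1 act_word v.
Proof.
elim=> [w|w w' _ IH|w w' w'' _ IH _ IH'|a b l r _ _ _ lr] x //.
- by rewrite IH IH'.
- rewrite !act_word_cat; congr act_word.
  by case: lr => [s|s|s t lt_st] /=; swap_lia.
Qed.

(* The word m-1, m-2, ..., j, which sends m to j. *)
Definition desc (m j : nat) : seq nat := rev (iota j (m - j)).

Lemma desc_recr m j : j < m -> desc m j = rcons (desc m j.+1) j.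
Proof.
by move=> ltjm; rewrite /desc -rev_cons -(subnSK ltjm).
Qed.

Lemma desc_lt m j : all (fun x => x < m) (desc m j).
Proof. by apply/allP=> x; rewrite mem_rev mem_iota; lia. Qed.

Lemma desc_cat m k j : j <= k <= m -> desc m j = desc m k ++ desc k j.
Proof.
move=> /andP[lejk lekm]; rewrite /desc -rev_cat; congr rev.
by rewrite -{2}(subnKC lejk) -iotaD; congr iota; lia.
Qed.

Lemma act_desc m j : j <= m -> act_word (desc m j) m = j.
Proof.
move=> lejm; have [k ->] : exists k, j = m - k by exists (m - j); lia.
elim: k => [|k IHk]; first by rewrite subn0 /desc subnn.
have [lemk|ltkm] := leqP m k.
  by have -> : m - k.+1 = m - k by lia.
rewrite desc_recr; last by lia.
rewrite -cats1 act_word_cat subnSK // IHk /=; swap_lia.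
Qed.

(** * Coset normal form and completeness of the Coxeter relations *)

Lemma cox_far_word m r u : all (fun x => x < m) u -> r < m ->
    all (fun x => (r.+1 < x) || (x.+1 < r)) u ->
  cox m (u ++ [:: r]) (r :: u).
Proof.
elim: u => [|x u IHu] /=; first by move=> *; exact: cox_refl.
move=> /andP[xm um] rm /andP[farx faru].
apply: cox_trans (_ : cox m ([:: x; r] ++ u) _).
  by apply: (@cox_catl m [:: x]); rewrite /= ?xm //; exact: IHu.
apply: (@cox_catr m u [:: x; r] [:: r; x]) => //.
case/orP: farx => far; first apply: cox_sym;
  by apply: cox_rel_cox; [rewrite /= xm rm|exact: cox_far].
Qed.

(** The words [desc m.+1 j] represent the right cosets of the parabolic subgroup with letters below
    [m]. A letter [r] on the right extends the word if [r.+1 = j], cancels its last letter if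
    [r = j], passes through unchanged if [r.+1 < j], and passes through as [r.-1] by one braid move
    if [r > j]. *)
Lemma desc_mul m j r : j <= m.+1 -> r < m.+1 ->
  exists u k, [/\ all (fun x => x < m) u, k <= m.+1
    & cox m.+1 (desc m.+1 j ++ [:: r]) (u ++ desc m.+1 k)].
Proof.
move=> lejm ltrm; set M := m.+1.
have far k l : k <= l -> l <= M -> all (fun x => x < M) (desc l k).
  by move=> lekl lelm; apply/allP=> x; rewrite mem_rev mem_iota /M; lia.
have [ltrj|ltjr|eqrj] := ltngtP r j.
- have [eqj|neqj] := eqVneq r.+1 j.
    exists [::], r; split=> //; first lia.
    rewrite -eqj cats1 -desc_recr //; exact: cox_refl.
  exists [:: r], j; split=> //=; first by rewrite andbT; lia.
  apply: cox_far_word => //; first exact: desc_lt.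
  by apply/allP=> x; rewrite mem_rev mem_iota; lia.
- case: r ltjr ltrm => // r ltjr ltrm.
  exists [:: r], j; split=> //=; first by rewrite andbT; lia.
  (* The letter is now called [r.+1]. It commutes left past [desc r j], the braid relation turns it
     into [r], and [r] commutes left past [desc M r.+2]. *)
  rewrite (@desc_cat M r.+2 j) ?(@desc_cat r.+2 r j); try (rewrite /M; lia).
  have -> : desc r.+2 r = [:: r.+1; r].
    by rewrite /desc -addn2 addKn.
  rewrite -!catA /=.
  apply: (@cox_trans _ _ (desc M r.+2 ++ [:: r.+1; r; r.+1] ++ desc r j)).
    apply: cox_catl; first exact: desc_lt.
    apply: (@cox_catl _ [:: r.+1; r]); first by rewrite /= /M; lia.
    apply: cox_far_word => //; first by apply: far; rewrite /M; lia.
    by apply/allP=> x; rewrite mem_rev mem_iota; lia.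
  apply: (@cox_trans _ _ (desc M r.+2 ++ [:: r; r.+1; r] ++ desc r j)).
    apply: cox_cat; [exact: desc_lt|by apply: far; rewrite /M; lia|].
    by apply: cox_sym; apply: cox_rel_cox; [rewrite /= /M; lia|exact: cox_braid].
  rewrite [desc M _ ++ _]/= -[X in _ ++ X]/([:: r] ++ [:: r.+1, r & desc r j]).
  rewrite catA -[X in cox _ _ X]/((r :: desc M r.+2) ++ [:: r.+1, r & desc r j]).
  apply: cox_catr; first by apply/and3P; split; [| |apply: far]; rewrite /M; lia.
  apply: cox_far_word => //; [exact: desc_lt|rewrite /M; lia|].
  by apply/allP=> x; rewrite mem_rev mem_iota; lia.
- exists [::], j.+1; split=> //=; first by lia.
  rewrite eqrj desc_recr; last by rewrite /M; lia.
  rewrite -cats1 -catA -[X in cox _ _ X]cats0; apply: cox_catl; first exact: desc_lt.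
  by apply: cox_rel_cox; [rewrite /= /M; lia|exact: cox_sq].
Qed.

Lemma cox_normal m u : all (fun x => x < m.+1) u ->
  exists u' j, [/\ all (fun x => x < m) u', j <= m.+1
    & cox m.+1 u (u' ++ desc m.+1 j)].
Proof.
elim/last_ind: u => [|u r IHu].
  by exists [::], m.+1; split; rewrite // /desc subnn; exact: cox_refl.
rewrite all_rcons => /andP[rm /IHu[u' [j [u'm lejm eqv]]]].
have [v [k [vm lekm eqv']]] := desc_mul lejm rm.
exists (u' ++ v), k; split=> //; first by rewrite all_cat u'm.
rewrite -cats1; apply: cox_trans (cox_catr _ eqv) _; first by rewrite /= rm.
rewrite -!catA; apply: cox_catl => //.
by apply: sub_all u'm => x; lia.
Qed.

(** In normal form the parabolic factor fixes the top point, so the image of that point determines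
    the coset representative. The common representative acts injectively and cancels, which leaves
    words of smaller rank. *)
Theorem cox_complete m u v :
  all (fun x => x < m) u -> all (fun x => x < m) v ->
  act_word u =1 act_word v -> cox m u v.
Proof.
elim: m u v => [|m IHm] u v um vm.
  case: u v um vm => [|x u] // [|y v] // _ _ _; exact: cox_refl.
have [u' [j [u'm lejm equ]]] := cox_normal um.
have [v' [k [v'm lekm eqv]]] := cox_normal vm.
move=> uv.
have {}uv x : act_word (u' ++ desc m.+1 j) x = act_word (v' ++ desc m.+1 k) x.
  by rewrite -(cox_act equ) -(cox_act eqv).
have eqjk : j = k.
  have := uv m.+1; rewrite !act_word_cat (act_word_gt u'm) // (act_word_gt v'm) //.
  by rewrite !act_desc.
apply: cox_trans equ (cox_trans _ (cox_sym eqv)); rewrite eqjk.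
apply: cox_catr; first exact: desc_lt.
apply: cox_widen (leqnSn m) (IHm _ _ u'm v'm _) => x.
by have := uv x; rewrite !act_word_cat eqjk => /act_word_inj.
Qed.

(** The coset word [c] sends [m.+1] to [f m.+1], so [f] followed by the inverse of [c] fixes [m.+1]
    and falls under the induction hypothesis. *)
Lemma act_word_surj m (f : nat -> nat) :
    injective f -> (forall x, m < x -> f x = x) ->
  exists2 u, all (fun x => x < m) u & act_word u =1 f.
Proof.
elim: m f => [|m IHm] f injf fixf.
  exists [::] => // x /=; case: x => [|x]; last by rewrite fixf.
  case ef : (f 0) => [|y] //.
  by have := fixf y.+1 isT; rewrite -ef => /injf.
set j := f m.+1.
have lejm : j <= m.+1.
  by rewrite leqNgt; apply/negP=> ltmj; have /injf := fixf _ ltmj; rewrite -/j; lia.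
pose c := desc m.+1 j.
have cK : cancel (act_word (rev c)) (act_word c).
  by move=> x; rewrite -{1}[c]revK act_word_revK.
have [|x ltmx|u um uE] := IHm (act_word (rev c) \o f).
- exact: inj_comp (@act_word_inj _) injf.
- rewrite /=; move: ltmx; rewrite leq_eqVlt => /predU1P[<-|ltmx].
    by rewrite -/j -{1}(act_desc lejm) act_word_revK.
  by rewrite fixf // (act_word_gt (m := m.+1)) // all_rev; exact: desc_lt.
- exists (u ++ c).
    rewrite all_cat desc_lt andbT; apply: sub_all um => x; lia.
  by move=> x; rewrite act_word_cat uE /= cK.
Qed.

(** * Partitions generated by a permutation and a list of pairs *)

Import GroupScope.

Section EdgePartitions.
Variable n : nat.
Implicit Types (w v : 'S_n) (S T : seq ('I_n * 'I_n)) (f : 'I_n -> 'I_n).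

Definition edge S : rel 'I_n := fun x y => ((x, y) \in S) || ((y, x) \in S).

Definition conn S : rel 'I_n := connect (edge S).

Definition map_pair f (p : 'I_n * 'I_n) : 'I_n * 'I_n := (f p.1, f p.2).

Lemma edge_sym S : symmetric (edge S).
Proof. by move=> x y; rewrite /edge orbC. Qed.

Lemma conn_sym S : connect_sym (edge S).
Proof. exact/sym_connect_sym/edge_sym. Qed.


(** Equivalences are compared through the functions constant on their classes: this condition splits
    over concatenation and commutes with pullback of the pairs, so no paths have to be handled. *)
Definition respects f S : bool := all (fun p => f p.1 == f p.2) S.

Lemma respects_cat f S T : respects f (S ++ T) = respects f S && respects f T.
Proof. exact: all_cat. Qed.

Lemma respects_map f g S : respects f (map (map_pair g) S) = respects (f \o g) S.
Proof. exact: all_map. Qed.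

Lemma conn_min S (e : rel 'I_n) : reflexive e -> symmetric e -> transitive e ->
  (forall p, p \in S -> e p.1 p.2) -> subrel (conn S) e.
Proof.
move=> erefl esym etrans Se x y /connectP[p]; elim: p x => [|z p IHp] x /=.
  by move=> _ ->.
case/andP=> xz pz lasty; apply: etrans (IHp _ pz lasty).
by case/orP: xz => /Se //=; rewrite esym.
Qed.

Lemma respects_conn f S x y : respects f S -> conn S x y -> f x = f y.
Proof.
move=> /allP fS xy; apply/eqP.
apply: (@conn_min S (fun x y => f x == f y)) xy => [u|u v|v u w /eqP->|] //.
Qed.

Lemma respects_root S : respects (root (edge S)) S.
Proof.
apply/allP=> -[x y] xyS /=; rewrite root_connect; last exact: conn_sym.
by apply: connect1; rewrite /edge xyS.
Qed.

(** The test function is [root (edge S)], whose fibres are exactly the classes of [conn S]. *)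
Lemma conn_sub S T : (forall f, respects f S -> respects f T) ->
  subrel (conn T) (conn S).
Proof.
move=> ST x y xyT; rewrite /conn -root_connect; last exact: conn_sym.
exact/eqP/(respects_conn (ST _ (respects_root S))).
Qed.

Lemma conn_eq S T : (forall f, respects f S = respects f T) -> conn S =2 conn T.
Proof.
by move=> ST x y; apply/idP/idP; apply: conn_sub => f; rewrite ST.
Qed.

Lemma conn_mem S p : p \in S -> conn S p.1 p.2.
Proof. by case: p => x y xyS; apply: connect1; rewrite /edge xyS. Qed.

Lemma conn_nil x y : conn [::] x y = (x == y).
Proof.
apply/idP/eqP => [|->]; last exact: connect0.
exact: (@respects_conn id).
Qed.

Lemma conn_single i j x y :
  conn [:: (i, j)] x y = (x == y) || (x \in [:: i; j]) && (y \in [:: i; j]).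
Proof.
apply/idP/idP.
  (* Collapsing [j] onto [i] is the universal function that respects the single pair. *)
  move=> /(@respects_conn (fun z => if z == j then i else z)) /=.
  rewrite /respects /= eqxx andbT !inE.
  have -> : (if i == j then i else i) == i by case: ifP.
  move/(_ isT); case: (eqVneq x j) => [->|_]; case: (eqVneq y j) => [->|_];
    try move=> ->; rewrite ?eqxx ?orbT //.
have cij : conn [:: (i, j)] i j by apply: (@conn_mem _ (i, j)); rewrite inE.
have cji : conn [:: (i, j)] j i by rewrite /conn conn_sym.
case/predU1P=> [->|]; first exact: connect0.
by rewrite !inE => /andP[/orP[]/eqP-> /orP[]/eqP->] //; exact: connect0.
Qed.

Definition top_of w (p : pt n) : 'I_n :=
  match split p with inl i => i | inr j => w^-1 j end.

Lemma top_of_lshift w i : top_of w (lshift n i) = i.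
Proof. by rewrite /top_of (unsplitK (inl _ i)). Qed.

Lemma top_of_rshift w i : top_of w (rshift n i) = w^-1 i.
Proof. by rewrite /top_of (unsplitK (inr _ i)). Qed.

Lemma ptP (p : pt n) : (exists i, p = lshift n i) \/ (exists i, p = rshift n i).
Proof. by case: (split_ordP p) => i ->; [left|right]; exists i. Qed.

(* If (I, J) is in R(S_n) with I given by w, then top i and bottom w(i) lie in the same
   block of J, so J is given by an equivalence on the top points, here the one
   generated by the pairs in [S]. *)
Definition edge_part w S : setpart n :=
  [set [set q | conn S (top_of w p) (top_of w q)] | p : pt n].

Lemma same_block_edge w S p q :
  same_block (edge_part w S) p q = conn S (top_of w p) (top_of w q).
Proof.
apply/exists_inP/idP => [[_ /imsetP[r _ ->]]|pq].
  rewrite !inE => /andP[rp rq]; apply: connect_trans rq.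
  by rewrite conn_sym.
exists [set q | conn S (top_of w p) (top_of w q)]; first exact: imset_f.
by rewrite !inE /conn connect0.
Qed.

Lemma edge_part_eq w S T : conn S =2 conn T -> edge_part w S = edge_part w T.
Proof. by move=> ST; apply: eq_imset => p; apply/setP=> q; rewrite !inE ST. Qed.

Lemma edge_part_partition w S : partition (edge_part w S) [set: pt n].
Proof.
apply/and3P; split.
- apply/eqP/setP=> q; rewrite !inE; apply/bigcupP.
  exists [set r | conn S (top_of w q) (top_of w r)]; first exact: imset_f.
  by rewrite inE /conn connect0.
- apply/trivIsetP=> _ _ /imsetP[p _ ->] /imsetP[q _ ->]; apply: contraNT.
  rewrite -setI_eq0 => /set0Pn[r]; rewrite !inE => /andP[pr qr].
  apply/eqP/setP=> s; rewrite !inE.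
  apply: same_connect; first exact: conn_sym.
  by apply: connect_trans pr _; rewrite conn_sym.
- apply/imsetP=> -[p _] /setP/(_ p); rewrite !inE /conn connect0.
  by [].
Qed.

Lemma perm_partE w : perm_part w = edge_part w [::].
Proof.
have blockE p : [set q | conn [::] (top_of w p) (top_of w q)] =
    [set lshift n (top_of w p); rshift n (w (top_of w p))].
  apply/setP=> q; rewrite !inE conn_nil.
  case: (ptP q) => -[i ->].
    by rewrite top_of_lshift eq_lshift eq_lrshift orbF eq_sym.
  by rewrite top_of_rshift eq_rlshift eq_rshift /= eq_sym (canF_eq (permKV w)).
apply/setP=> B; apply/imsetP/imsetP => -[x _ ->].
  by exists (lshift n x); rewrite // blockE top_of_lshift.
by exists (top_of w x).
Qed.

Lemma edge_part_inj w v S T :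
  edge_part w S = edge_part v T -> conn S =2 conn T.
Proof.
move=> wv x y; have := same_block_edge w S (lshift n x) (lshift n y).
by rewrite wv same_block_edge !top_of_lshift.
Qed.

Lemma perm_part_inj : injective (@perm_part n).
Proof.
move=> w v; rewrite !perm_partE => wv; apply/permP=> i.
have := same_block_edge w [::] (lshift n i) (rshift n (w i)).
rewrite wv same_block_edge !top_of_lshift !top_of_rshift permK !conn_nil eqxx.
by move/eqP=> {2}->; rewrite permKV.
Qed.

Lemma JmergeE i j : Jmerge i j = edge_part 1 [:: (i, j)].
Proof.
have blockE p : [set q | conn [:: (i, j)] (top_of 1 p) (top_of 1 q)] =
    if top_of 1 p \in [:: i; j]
    then [set lshift n i; rshift n i; lshift n j; rshift n j]
    else [set lshift n (top_of 1 p); rshift n (top_of 1 p)].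
  apply/setP=> q; rewrite inE conn_single.
  have top1 k : top_of 1 q == k = (q \in [set lshift n k; rshift n k]).
    rewrite !inE; case: (ptP q) => -[l ->].
      by rewrite top_of_lshift eq_lshift eq_lrshift orbF.
    by rewrite top_of_rshift invg1 perm1 eq_rlshift eq_rshift.
  case: ifPn => [tp|ntp]; last by rewrite orbF eq_sym top1.
  have -> : (q \in [set lshift n i; rshift n i; lshift n j; rshift n j]) =
      (top_of 1 q \in [:: i; j]) by rewrite !inE !top1 !inE !orbA.
  by apply/orP/idP => [[/eqP<-|]|->] //; right.
apply/setP=> B; rewrite /Jmerge inE !inE; apply/orP/imsetP.
  case=> [/andP[/imsetP[k _ ->]]|/eqP->].
    rewrite !inE !eq_lshift !eq_lrshift !orbF perm1 => /andP[ik jk].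
    exists (lshift n k) => //; rewrite blockE top_of_lshift !inE.
    by rewrite ![k == _]eq_sym (negPf ik) (negPf jk).
  by exists (lshift n i); rewrite // blockE top_of_lshift !inE eqxx.
case=> p _ ->; rewrite blockE; case: ifPn => [_|ntp]; first by right.
left; apply/and3P; split.
- by apply/imsetP; exists (top_of 1 p); rewrite // perm1.
- by move: ntp; rewrite !inE eq_lshift eq_lrshift orbF eq_sym; case: eqP.
- by move: ntp; rewrite !inE eq_lshift eq_lrshift orbF orbC eq_sym; case: eqP.
Qed.

(** Every vertex of the diagram lies on a line of [w * v] and is labelled by the top end of that
    line. The top row of the second factor is the middle row, so its pairs are pulled back by
    [w^-1]. *)
Lemma pconcat_edge w v S T : pconcat (edge_part w S) (edge_part v T) =
  edge_part (w * v) (S ++ map (map_pair w^-1) T).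
Proof.
set I := edge_part w S; set J := edge_part v T; set U := S ++ _.
pose tp (u : cvert n) := match u with
  | inl p => top_of (w * v) p | inr m => w^-1 m end.
have tpI u x : ptI u = Some x -> top_of w x = tp u.
  case: u => [p|m] /=; last by case=> <-; rewrite top_of_rshift.
  rewrite /tp {2}/top_of; case: (split p) => // i [<-]; exact: top_of_lshift.
have tpJ u y : ptJ u = Some y -> w^-1 (top_of v y) = tp u.
  case: u => [p|m] /=; last by case=> <-; rewrite top_of_lshift.
  rewrite /tp {2}/top_of; case: (split p) => // j [<-].
  by rewrite top_of_rshift invMg permM.
have connT x y : conn T x y -> conn U (w^-1 x) (w^-1 y).
  move=> xy; rewrite /conn -root_connect; last exact: conn_sym.
  have := respects_root U; rewrite respects_cat respects_map => /andP[_ rT].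
  exact/eqP/(respects_conn rT xy).
have connS x y : conn S x y -> conn U x y.
  by apply: conn_sub => f; rewrite respects_cat => /andP[].
(* One inclusion: an edge of the diagram joins vertices with equivalent labels. *)
have tpP u u' : cedge I J u u' -> conn U (tp u) (tp u').
  case/orP; rewrite /orel.
    case eu: (ptI u) => [x|] //; case eu': (ptI u') => [x'|] //.
    by rewrite same_block_edge (tpI u x) // (tpI u' x') //; exact: connS.
  case eu: (ptJ u) => [x|] //; case eu': (ptJ u') => [x'|] //.
  by rewrite same_block_edge -(tpJ u x) // -(tpJ u' x') //; exact: connT.
have cedge_sym : connect_sym (cedge I J).
  apply: sym_connect_sym => u u'; rewrite /cedge; congr orb; rewrite /orel;
  by case: (_ u) => [x|]; case: (_ u') => [x'|] //; rewrite !same_block_edge;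
    exact: conn_sym.
have midI x y : conn S x y -> connect (cedge I J) (inr (w x)) (inr (w y)).
  move=> xy; apply: connect1; rewrite /cedge /=.
  by rewrite same_block_edge !top_of_rshift !permK xy.
have midJ x y : conn T x y -> connect (cedge I J) (inr x) (inr y).
  move=> xy; apply: connect1; rewrite /cedge /=.
  by rewrite orbC same_block_edge !top_of_lshift xy.
(* The other inclusion goes through the middle row: equivalent labels give connected middle
   vertices, and [to_mid] links each vertex to the middle vertex of its line. *)
have mid x y : conn U x y -> connect (cedge I J) (inr (w x)) (inr (w y)).
  move=> /connectP[p]; elim: p x => [|z p IHp] x /=.
    by move=> _ ->; exact: connect0.
  case/andP=> xz pz lasty; apply: connect_trans (IHp _ pz lasty).
  have {xz}: (x, z) \in U \/ (z, x) \in U by exact/orP.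
  wlog: x z {pz lasty} / (x, z) \in U => [wl [xz|zx]|xz _].
  - by apply: wl => //; left.
  - by rewrite cedge_sym; apply: wl => //; left.
  move: xz; rewrite mem_cat => /orP[/conn_mem/midI //|/mapP[[a b] abT [-> ->]]].
  by rewrite /= !permKV; apply: midJ; exact: conn_mem abT.
have to_mid u : connect (cedge I J) u (inr (w (tp u))).
  case: u => [p|m]; last by rewrite /= permKV connect0.
  apply: connect1; rewrite /cedge /=; case: (ptP p) => -[i ->].
    rewrite top_of_lshift (unsplitK (inl _ i)) /=.
    by rewrite same_block_edge top_of_lshift top_of_rshift permK /conn connect0.
  rewrite top_of_rshift (unsplitK (inr _ i)) /= invMg permM permKV.
  by rewrite same_block_edge top_of_lshift top_of_rshift /conn connect0.
apply: eq_imset => p; apply/setP=> q; rewrite !inE; apply/idP/idP.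
  move=> /connectP[s]; rewrite -[top_of _ p]/(tp (inl p)).
  elim: s (inl p) => [|u s IHs] u0 /=.
    by move=> _ <-; exact: connect0.
  case/andP=> u0u us lastq.
  exact: connect_trans (tpP _ _ u0u) (IHs _ us lastq).
move/mid=> pq; apply: connect_trans (to_mid (inl p)) (connect_trans pq _).
by rewrite cedge_sym; exact: to_mid.
Qed.

Definition edge_elt w S : relt n := (edge_part w [::], edge_part w S).

Lemma edge_elt_mul w v S T :
  rmul (edge_elt w S) (edge_elt v T) = edge_elt (w * v) (S ++ map (map_pair w^-1) T).
Proof. by rewrite /rmul /= !pconcat_edge. Qed.

Lemma edge_elt_eq w v S T :
  edge_elt w S = edge_elt v T <-> w = v /\ conn S =2 conn T.
Proof.
split=> [[]|[-> /edge_part_eq ST]]; last by rewrite /edge_elt ST.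
by rewrite -!perm_partE => /perm_part_inj-> /edge_part_inj.
Qed.

Lemma edge_part_refines w S : refines (perm_part w) (edge_part w S).
Proof.
move=> _ /imsetP[p _ ->].
set B := [set q | _]; exists [set C in perm_part w | C \subset B].
split; first by apply/subsetP=> C; rewrite inE => /andP[].
apply/setP=> q; apply/bigcupP/idP => [[C]|qB].
  by rewrite inE => /andP[_ /subsetP CB] /CB.
exists [set r | conn [::] (top_of w q) (top_of w r)]; last first.
  by rewrite inE conn_nil.
rewrite inE perm_partE imset_f //=; apply/subsetP=> r.
by rewrite inE conn_nil => /eqP qr; move: qB; rewrite !inE qr.
Qed.

Lemma edge_elt_in_sR w S p : p \in S -> p.1 != p.2 -> in_sR (edge_elt w S).
Proof.
move=> pS neqp; split; first split.
- by exists w; rewrite perm_partE.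
- by split; [exact: edge_part_partition|rewrite /= -perm_partE; exact: edge_part_refines].
- by move=> /= /edge_part_inj/(_ p.1 p.2); rewrite (conn_mem pS) conn_nil (negPf neqp).
Qed.

(** * Elements of sR(S_n) as a permutation with a nonempty list of pairs *)

Lemma same_block_equiv (J : setpart n) : partition J [set: pt n] ->
  [/\ reflexive (same_block J), symmetric (same_block J) & transitive (same_block J)].
Proof.
case/and3P=> /eqP covJ trivJ _; split=> [p|p q|q p r].
- have : p \in cover J by rewrite covJ inE.
  by case/bigcupP=> B BJ pB; apply/exists_inP; exists B; rewrite ?pB.
- by rewrite /same_block; apply: eq_existsb => B; rewrite [_ && (q \in B)]andbC.
- case/exists_inP=> B BJ /andP[pB qB] /exists_inP[C CJ /andP[qC rC]].
  apply/exists_inP; exists B => //; rewrite pB.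
  by rewrite -(def_pblock trivJ BJ qB) (def_pblock trivJ CJ qC).
Qed.

Lemma same_block_inj (J K : setpart n) :
    partition J [set: pt n] -> partition K [set: pt n] ->
  same_block J =2 same_block K -> J = K.
Proof.
suff sub J' K' : partition J' [set: pt n] -> partition K' [set: pt n] ->
    same_block J' =2 same_block K' -> J' \subset K'.
  move=> pJ pK JK; apply/eqP; rewrite eqEsubset !sub //.
move=> /and3P[_ trivJ ntJ] /and3P[/eqP covK trivK _] JK; apply/subsetP=> B BJ.
have [p pB] : exists p, p \in B.
  by apply/set0Pn; apply: contraNneq ntJ => <-.
have : p \in cover K' by rewrite covK inE.
case/bigcupP=> C CK pC; suff -> : B = C by [].
have blockE (L : setpart n) D q : trivIset L -> D \in L -> p \in D ->
    (q \in D) = same_block L p q.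
  move=> trivL DL pD; apply/idP/exists_inP => [qD|[D' D'L /andP[pD' qD']]].
    by exists D; rewrite ?pD.
  by rewrite -(def_pblock trivL DL pD) (def_pblock trivL D'L pD').
by apply/setP=> q; rewrite (blockE J') // (blockE K').
Qed.

Lemma in_sR_edge x : in_sR x ->
  exists w S, [/\ x = edge_elt w S, S != [::] & all (fun p : 'I_n * 'I_n => p.1 < p.2) S].
Proof.
case: x => I J [[/= [w ->] [partJ refJ]] neqJ].
have [Jrefl Jsym Jtrans] := same_block_equiv partJ.
(* By refinement, the line of [w] through [p] stays inside the block of [p], and that line contains
   the top end. *)
have Jtop p : same_block J p (lshift n (top_of w p)).
  have := Jrefl p; case/exists_inP=> B BJ /andP[pB _].
  apply/exists_inP; exists B => //; rewrite pB /=.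
  have [S [SI eqB]] := refJ B BJ; rewrite -eqB in pB *.
  case/bigcupP: pB => C CS pC; apply/bigcupP; exists C => //.
  have := subsetP SI _ CS; rewrite perm_partE => /imsetP[q _ eqC].
  by move: pC; rewrite eqC !inE top_of_lshift.
(* All increasing pairs of top points in a common block. An empty list would make [J] equal to the
   partition of [w], which is excluded. *)
pose S := [seq p : 'I_n * 'I_n <- enum {: 'I_n * 'I_n} |
  (p.1 < p.2) && same_block J (lshift n p.1) (lshift n p.2)].
have connE i j : conn S i j = same_block J (lshift n i) (lshift n j).
  apply/idP/idP.
    apply: (@conn_min S (fun i j => same_block J (lshift n i) (lshift n j))) => //.
    - by move=> l k m; exact: Jtrans.
    - by move=> p; rewrite mem_filter => /andP[/andP[]].
  move=> ij; have [ltij|ltji|/ord_inj->] := ltngtP i j; last exact: connect0.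
    by apply: (@conn_mem _ (i, j)); rewrite mem_filter /= ltij ij mem_enum.
  rewrite /conn conn_sym; apply: (@conn_mem _ (j, i)).
  by rewrite mem_filter /= ltji Jsym ij mem_enum.
have Jtop' p : same_block J (lshift n (top_of w p)) p by rewrite Jsym.
have eqJ : J = edge_part w S.
  apply: same_block_inj => //; first exact: edge_part_partition.
  move=> p q; rewrite same_block_edge connE; apply/idP/idP => pq.
    exact: (Jtrans _ _ _ (Jtrans _ _ _ (Jtop' p) pq) (Jtop q)).
  exact: (Jtrans _ _ _ (Jtrans _ _ _ (Jtop p) pq) (Jtop' q)).
exists w, S; split.
- by rewrite /edge_elt -perm_partE -eqJ.
- by apply/eqP=> S0; apply: neqJ; rewrite eqJ S0 perm_partE.
- by apply/allP=> p; rewrite mem_filter => /andP[/andP[]].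
Qed.

End EdgePartitions.

(** * Words in the generators *)

Section Words.
Variable n : nat.
Implicit Types (u v a b : seq (gen n)) (S T : seq ('I_n * 'I_n)) (f : 'I_n -> 'I_n)
  (i j h k r t : 'I_n) (rs : seq nat).

Definition gen_perm (g : gen n) : 'S_n :=
  match g with GE _ _ => 1 | GZ r _ _ => sr r end.

Definition gen_pair (g : gen n) : 'I_n * 'I_n :=
  match g with GE i j => (i, j) | GZ _ i j => (i, j) end.

Definition word_perm u : 'S_n := \prod_(g <- u) gen_perm g.

(* Each pair is pulled back to the top row through the preceding permutations. *)
Fixpoint word_edges u : seq ('I_n * 'I_n) :=
  match u with
  | [::] => [::]
  | g :: u' => gen_pair g :: map (map_pair (gen_perm g)^-1) (word_edges u')
  end.

Definition word_letters u : seq nat :=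
  pmap (fun g => if g is GZ r _ _ then Some (val r) else None) u.

Lemma word_perm_cat u v : word_perm (u ++ v) = word_perm u * word_perm v.
Proof. exact: big_cat. Qed.

Lemma map_pair_comp (f g : 'I_n -> 'I_n) S :
  map (map_pair f) (map (map_pair g) S) = map (map_pair (f \o g)) S.
Proof. by rewrite -map_comp. Qed.

Lemma map_pair1 S : map (map_pair (1 : 'S_n)^-1) S = S.
Proof.
by rewrite -[RHS]map_id; apply: eq_map => -[i j]; rewrite /map_pair invg1 !perm1.
Qed.

Lemma map_pairM (w v : 'S_n) S :
  map (map_pair (w * v)^-1) S = map (map_pair w^-1) (map (map_pair v^-1) S).
Proof.
by rewrite map_pair_comp; apply: eq_map => -[i j]; rewrite /map_pair /= invMg !permM.
Qed.

Lemma word_edges_cons g u :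
  word_edges (g :: u) = gen_pair g :: map (map_pair (gen_perm g)^-1) (word_edges u).
Proof. by []. Qed.

Lemma word_edges_cat u v :
  word_edges (u ++ v) = word_edges u ++ map (map_pair (word_perm u)^-1) (word_edges v).
Proof.
elim: u => [|g u IHu] /=; first by rewrite /word_perm big_nil map_pair1.
by rewrite IHu map_cat -map_pairM /word_perm big_cons.
Qed.

Lemma gval_edge g : Defs.gval g = edge_elt (gen_perm g) [:: gen_pair g].
Proof.
have eE i j : e_elt i j = edge_elt 1 [:: (i, j)].
  by rewrite /e_elt JmergeE perm_partE.
case: g => [i j|r i j] /=; first exact: eE.
by rewrite /z_elt eE /s_elt perm_partE edge_elt_mul mul1g.
Qed.

Lemma evalw_edge u : evalw u = edge_elt (word_perm u) (word_edges u).
Proof.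
case: u => [|g u] /=; first by rewrite /word_perm big_nil /edge_elt perm_partE.
rewrite /word_perm big_cons gval_edge.
(* The fold brackets to the left, so the accumulator is generalized to any element of the form
   [edge_elt w S]. *)
suff foldE x w S : x = edge_elt w S -> foldl (fun y (k : gen n) => rmul y (Defs.gval k)) x u =
    rmul (edge_elt w S) (edge_elt (word_perm u) (word_edges u)).
  by rewrite (foldE _ _ _ erefl) edge_elt_mul.
elim: u x w S => [|h u IHu] x w S ->.
  by rewrite /= /word_perm big_nil edge_elt_mul mulg1 cats0.
rewrite /= gval_edge edge_elt_mul (IHu _ _ _ erefl) /word_perm big_cons !edge_elt_mul /=.
by rewrite -catA mulgA map_pairM.
Qed.

Lemma sr_val r i : r.+1 < n -> val (sr r i) = adj_swap r i.
Proof.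
move=> ltrn; rewrite /sr.
have vi : nat_of_ord (insubd r r.+1) = r.+1 by have := val_insubd r r.+1; rewrite ltrn.
case: tpermP => [->|->|ir ir1] /=; rewrite ?vi; try swap_lia.
have neqr : nat_of_ord i <> r by move=> /ord_inj.
have neqr1 : nat_of_ord i <> r.+1 by rewrite -vi => /ord_inj.
by swap_lia.
Qed.

Lemma srK r : involutive (sr r).
Proof. exact: tpermK. Qed.

Lemma srV r : (sr r)^-1 = sr r.
Proof. exact: tpermV. Qed.

Lemma sr_neq r i j : i != j -> sr r i != sr r j.
Proof. by rewrite (inj_eq perm_inj). Qed.

Lemma E_lt i j : i < j -> E i j = GE i j.
Proof. by move=> ltij; rewrite /E /oming /omaxg ltij. Qed.

Lemma Z_lt r i j : i < j -> Z r i j = GZ r i j.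
Proof. by move=> ltij; rewrite /Z /oming /omaxg ltij. Qed.

Lemma oming_omaxg_sym i j : (oming i j = oming j i) * (omaxg i j = omaxg j i).
Proof. by rewrite /oming /omaxg; case: ltngtP => // /ord_inj->. Qed.

Lemma E_sym i j : E i j = E j i.
Proof. by rewrite /E !(oming_omaxg_sym i j). Qed.

Lemma Z_sym r i j : Z r i j = Z r j i.
Proof. by rewrite /Z !(oming_omaxg_sym i j). Qed.

Lemma E_valid i j : i != j -> valid_gen (E i j).
Proof.
rewrite /= /oming /omaxg => neqij; case: (ltngtP i j) => // /ord_inj eqij.
by rewrite eqij eqxx in neqij.
Qed.

Lemma Z_valid r i j : r.+1 < n -> i != j -> valid_gen (Z r i j).
Proof. by move=> ltr /(@E_valid i j) /= ->; rewrite ltr. Qed.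

(** * Soundness of the relations *)

Lemma respects_gen f g S : respects f (gen_pair g :: S) =
  (f (gen_pair g).1 == f (gen_pair g).2) && respects f S.
Proof. by []. Qed.

Lemma gen_pair_E f i j : (f (gen_pair (E i j)).1 == f (gen_pair (E i j)).2) = (f i == f j).
Proof. by rewrite /E /oming /omaxg /=; case: ifP => // _; rewrite eq_sym. Qed.

Lemma gen_pair_Z f r i j :
  (f (gen_pair (Z r i j)).1 == f (gen_pair (Z r i j)).2) = (f i == f j).
Proof. exact: gen_pair_E. Qed.

Lemma perm_val_eq (w w' : 'S_n) : (forall i, val (w i) = val (w' i)) -> w = w'.
Proof. by move=> ww'; apply/permP=> i; exact: val_inj. Qed.

Lemma sr_far r t : r.+1 < n -> t.+1 < n -> 1 < dist r t -> sr r * sr t = sr t * sr r.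
Proof.
move=> ltr ltt; rewrite /dist => drt; apply: perm_val_eq => i.
by rewrite !permM !sr_val //; swap_lia.
Qed.

Lemma sr_braid r t : r.+1 < n -> t.+1 < n -> dist r t = 1%N ->
  sr r * (sr t * sr r) = sr t * (sr r * sr t).
Proof.
move=> ltr ltt; rewrite /dist => drt; apply: perm_val_eq => i.
rewrite !permM !sr_val //; have [-> | ->] : val t = r.+1 \/ val r = t.+1 by simpl; lia.
all: swap_lia.
Qed.

(** Stated with [respects] instead of [conn] so that it passes through contexts on both sides: a
    left context only precomposes [f] with a permutation. *)
Definition same_image u v : Prop := word_perm u = word_perm v /\
  forall f, respects f (word_edges u) = respects f (word_edges v).

Lemma relax_same_image u v : relax u v -> same_image u v.
Proof.
have rE f i j S : respects f (gen_pair (E i j) :: S) = (f i == f j) && respects f S.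
  by rewrite respects_gen gen_pair_E.
have rZ f r i j S : respects f (gen_pair (Z r i j) :: S) = (f i == f j) && respects f S.
  by rewrite respects_gen gen_pair_Z.
have eE w i j : word_edges (E i j :: w) = gen_pair (E i j) :: word_edges w.
  by rewrite /= map_pair1.
have eZ r w i j : word_edges (Z r i j :: w) =
    gen_pair (Z r i j) :: map (map_pair (sr r)) (word_edges w).
  by rewrite /= srV.
have tri (x y z : 'I_n) : (x == y) && (x == z) = (x == y) && (y == z).
  by case: eqP => // ->.
have tri' (x y z : 'I_n) : (x == y) && (y == z) = (x == z) && (y == z).
  by case: (eqVneq y z) => [->|]; rewrite ?andbF.
case=> [[i [j [_ [-> ->]]]]|]; last
case=> [[i [j [r [s [_ [_ [-> ->]]]]]]]|]; last
case=> [[i [j [k [_ [-> ->]]]]]|]; last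
case=> [[i [j [k [_ [-> ->]]]]]|]; last
case=> [[r [t [i [j [ltr [ltt [drt [_ [-> ->]]]]]]]]]|]; last
case=> [[r [t [i [j [ltr [ltt [drt [_ [-> ->]]]]]]]]]|]; last
case=> [[r [i [j [h [k [ltr [_ [_ [-> ->]]]]]]]]]|]; last
case=> [[r [i [j [ltr [_ [-> ->]]]]]]|[r [i [j [h [k [ltr [_ [_ [-> ->]]]]]]]]]].
all: split; first rewrite /word_perm !big_cons !big_nil /= ?mulg1 ?mul1g //.
all: try move=> f; rewrite ?(eE, eZ, rE, rZ, respects_map, map_cons) /= ?andbT
  ?srK ?andbb //.
- exact: andbC.
- exact: sr_braid.
- exact: sr_far.
- exact: tperm2.
- exact: andbC.
Qed.

Lemma wcong_same_image u v : wcong u v -> same_image u v.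
Proof.
elim=> [w|w w' _ [wp wf]|w w' w'' _ [wp wf] _ [wp' wf']|a b l r _ _ /relax_same_image[lr lrf]].
- by [].
- by split=> // f; rewrite wf.
- by split=> [|f]; rewrite ?wp ?wf.
- split; first by rewrite !word_perm_cat lr.
  by move=> f; rewrite !(word_edges_cat, respects_cat, respects_map) lrf lr.
Qed.

Lemma wcong_evalw u v : wcong u v -> evalw u = evalw v.
Proof.
move=> /wcong_same_image[uv uvf]; rewrite !evalw_edge; apply/edge_elt_eq.
by split=> //; exact: conn_eq.
Qed.

(** * The relations for unordered pairs of indices, in front of an arbitrary tail *)

Notation valid := (all (@valid_gen n)).
Infix "~~" := (@wcong n) (at level 70).

Lemma wcong_cat a b u v : valid a -> valid b -> u ~~ v -> a ++ u ++ b ~~ a ++ v ++ b.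
Proof.
move=> va vb; elim=> [w|w w' _|w w' w'' _ IH _|c d l r vc vd lr].
- exact: wc_refl.
- exact: wc_sym.
- exact: wc_trans IH.
- rewrite -!catA ![a ++ (c ++ _)]catA.
  by apply: wc_ctx lr; rewrite all_cat ?va ?vb ?vc ?vd.
Qed.

Lemma wcong_catl a u v : valid a -> u ~~ v -> a ++ u ~~ a ++ v.
Proof. by move=> va /(@wcong_cat a [::]); rewrite !cats0; apply. Qed.

Lemma wcong_cons g u v : valid_gen g -> u ~~ v -> g :: u ~~ g :: v.
Proof. by move=> vg; apply: (@wcong_catl [:: g]); rewrite /= vg. Qed.

Lemma relax_wcong u v w : valid w -> relax u v -> u ++ w ~~ v ++ w.
Proof. exact: (@wc_ctx n [::]). Qed.

Lemma valid_E_cons i j w : i != j -> valid w -> valid (E i j :: w).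
Proof. by move=> ij vw; apply/andP; split; first exact: E_valid. Qed.

Lemma valid_Z_cons r i j w : r.+1 < n -> i != j -> valid w -> valid (Z r i j :: w).
Proof. by move=> ltr ij vw; apply/andP; split; first exact: Z_valid. Qed.

Lemma valid_cat u v : valid u -> valid v -> valid (u ++ v).
Proof. by move=> vu vv; rewrite all_cat vu. Qed.

Hint Resolve valid_E_cons valid_Z_cons valid_cat E_valid Z_valid sr_neq : gens.

(** The relations are given for increasing indices, but the indices moved by [sr] come in any order;
    this extends each relation to all distinct pairs. *)
Lemma sym_pair_ind (P : 'I_n -> 'I_n -> Prop) : (forall i j, P i j -> P j i) ->
  (forall i j, i < j -> P i j) -> forall i j, i != j -> P i j.
Proof.
move=> symP ltP i j; rewrite -val_eqE neq_ltn => /orP[/ltP //|/ltP].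
exact: symP.
Qed.

Section Tail.
Variable w : seq (gen n).
Hypothesis vw : valid w.

Lemma E_idem i j : i != j -> [:: E i j, E i j & w] ~~ E i j :: w.
Proof.
apply: (@sym_pair_ind (fun i j => [:: E i j, E i j & w] ~~ E i j :: w)) => {}i {}j.
  by rewrite E_sym.
move=> ltij; apply: (@relax_wcong [:: _; _] [:: _]) => //.
by left; exists i, j.
Qed.

Lemma E_comm i j h k : i != j -> h != k ->
  [:: E i j, E h k & w] ~~ [:: E h k, E i j & w].
Proof.
apply: (@sym_pair_ind (fun i j => h != k ->
  [:: E i j, E h k & w] ~~ [:: E h k, E i j & w])) => {}i {}j; first by rewrite E_sym.
move=> ltij.
apply: (@sym_pair_ind (fun h k =>
  [:: E i j, E h k & w] ~~ [:: E h k, E i j & w])) => {}h {}k; first by rewrite (E_sym h).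
move=> lthk; apply: (@relax_wcong [:: _; _] [:: _; _]) => //.
by right; left; exists i, j, h, k.
Qed.

Lemma E_tri i j k : i != j -> i != k -> j != k ->
  [:: E i j, E i k & w] ~~ [:: E i j, E j k & w].
Proof.
(* [T] says that all three products agree. It is stable under both adjacent exchanges of its
   arguments, so the increasing case yields every order. *)
pose T (x y z : 'I_n) := [:: E x y, E x z & w] ~~ [:: E x y, E y z & w] /\
  [:: E x y, E y z & w] ~~ [:: E x z, E y z & w].
have T_lt (x y z : 'I_n) : x < y -> y < z -> T x y z.
  move=> xy yz; have xyz : x < y < z by rewrite xy.
  split; apply: (@relax_wcong [:: _; _] [:: _; _]) => //.
    by do 2!right; left; exists x, y, z.
  by do 3!right; left; exists x, y, z.
have T_swap12 (x y z : 'I_n) : x != z -> y != z -> T x y z -> T y x z.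
  move=> xz yz [t1 t2]; rewrite /T (E_sym y x); split; first exact: wc_sym.
  by apply: (wc_trans t1 (wc_trans t2 _)); exact: E_comm.
have T_swap23 (x y z : 'I_n) : x != y -> x != z -> T x y z -> T x z y.
  move=> xy xz [t1 t2]; rewrite /T (E_sym z y); split; last exact: wc_sym.
  by apply: (wc_trans (E_comm _ _) (wc_trans t1 t2)).
move=> ij ik jk; suff [] : T i j k by [].
have ji : j != i by rewrite eq_sym.
have ki : k != i by rewrite eq_sym.
have kj : k != j by rewrite eq_sym.
have cmp (x y : 'I_n) : x != y -> x < y \/ y < x by rewrite -val_eqE neq_ltn => /orP.
case: (cmp _ _ ij) => ltij; case: (cmp _ _ jk) => ltjk; case: (cmp _ _ ik) => ltik.
- exact: T_lt.
- exact: T_lt.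
- by apply: (T_swap23) => //; apply: T_lt.
- by apply: (T_swap23) => //; apply: (T_swap12) => //; apply: T_lt.
- by apply: (T_swap12) => //; apply: T_lt.
- by apply: (T_swap12) => //; apply: (T_swap23) => //; apply: T_lt.
- by apply: (T_swap12) => //; apply: (T_swap23) => //; apply: (T_swap12) => //; apply: T_lt.
- by apply: (T_swap12) => //; apply: (T_swap23) => //; apply: (T_swap12) => //; apply: T_lt.
Qed.

Lemma EZ_absorb r i j : r.+1 < n -> i != j -> [:: E i j, Z r i j & w] ~~ Z r i j :: w.
Proof.
move=> ltr; apply: (@sym_pair_ind (fun i j =>
  [:: E i j, Z r i j & w] ~~ Z r i j :: w)) => {}i {}j.
  by rewrite E_sym Z_sym.
move=> ltij; apply: (@relax_wcong [:: _; _] [:: _]) => //.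
by do 7!right; left; exists r, i, j.
Qed.

Lemma ZZ r i j h k : r.+1 < n -> i != j -> h != k ->
  [:: Z r i j, Z r h k & w] ~~ [:: E i j, E (sr r h) (sr r k) & w].
Proof.
move=> ltr; apply: (@sym_pair_ind (fun i j => h != k ->
  [:: Z r i j, Z r h k & w] ~~ [:: E i j, E (sr r h) (sr r k) & w])) => {}i {}j.
  by rewrite E_sym Z_sym.
move=> ltij; apply: (@sym_pair_ind (fun h k =>
  [:: Z r i j, Z r h k & w] ~~ [:: E i j, E (sr r h) (sr r k) & w])) => {}h {}k.
  by rewrite (Z_sym r h) (E_sym (sr r h)).
move=> lthk; apply: (@relax_wcong [:: _; _] [:: _; _]) => //.
by do 6!right; left; exists r, i, j, h, k.
Qed.

Lemma ZE_comm r i j h k : r.+1 < n -> i != j -> h != k ->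
  [:: Z r i j, E h k & w] ~~ [:: E (sr r h) (sr r k), Z r i j & w].
Proof.
move=> ltr; apply: (@sym_pair_ind (fun i j => h != k ->
  [:: Z r i j, E h k & w] ~~ [:: E (sr r h) (sr r k), Z r i j & w])) => {}i {}j.
  by rewrite Z_sym.
move=> ltij; apply: (@sym_pair_ind (fun h k =>
  [:: Z r i j, E h k & w] ~~ [:: E (sr r h) (sr r k), Z r i j & w])) => {}h {}k.
  by rewrite (E_sym h) (E_sym (sr r h)).
move=> lthk; apply: (@relax_wcong [:: _; _] [:: _; _]) => //.
by do 8!right; exists r, i, j, h, k.
Qed.

Lemma EZ_comm r i j h k : r.+1 < n -> i != j -> h != k ->
  [:: E h k, Z r i j & w] ~~ [:: Z r i j, E (sr r h) (sr r k) & w].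
Proof.
move=> ltr ij hk; apply: wc_sym; rewrite -{2}(srK r h) -{2}(srK r k).
by apply: ZE_comm; rewrite ?sr_neq.
Qed.

Lemma Z_braid r t i j : r.+1 < n -> t.+1 < n -> dist r t = 1%N -> i != j ->
  [:: Z r i j, Z t (sr r i) (sr r j),
      Z r (sr t (sr r i)) (sr t (sr r j)) & w] ~~
  [:: Z t i j, Z r (sr t i) (sr t j),
      Z t (sr r (sr t i)) (sr r (sr t j)) & w].
Proof.
move=> ltr ltt drt; apply: (@sym_pair_ind (fun i j => [:: Z r i j, Z t (sr r i) (sr r j),
      Z r (sr t (sr r i)) (sr t (sr r j)) & w] ~~
  [:: Z t i j, Z r (sr t i) (sr t j),
      Z t (sr r (sr t i)) (sr r (sr t j)) & w])) => {}i {}j.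
  by rewrite !(Z_sym _ j) !(Z_sym _ (sr _ j)) !(Z_sym _ (sr _ (sr _ j))).
move=> ltij; apply: (@relax_wcong [:: _; _; _] [:: _; _; _]) => //.
by do 4!right; left; exists r, t, i, j.
Qed.

Lemma Z_far r t i j : r.+1 < n -> t.+1 < n -> 1 < dist r t -> i != j ->
  [:: Z r i j, Z t (sr r i) (sr r j) & w] ~~ [:: Z t i j, Z r (sr t i) (sr t j) & w].
Proof.
move=> ltr ltt drt; apply: (@sym_pair_ind (fun i j =>
  [:: Z r i j, Z t (sr r i) (sr r j) & w] ~~ [:: Z t i j, Z r (sr t i) (sr t j) & w]))
  => {}i {}j.
  by rewrite !(Z_sym _ j) !(Z_sym _ (sr _ j)).
move=> ltij; apply: (@relax_wcong [:: _; _] [:: _; _]) => //.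
by do 5!right; left; exists r, t, i, j.
Qed.

End Tail.

(** * Normal form of a word: a product of e's followed by a chain *)

Definition E_word S : seq (gen n) := [seq E p.1 p.2 | p <- S].

(* [Z r1 i j; Z r2 (r1 i) (r1 j); ...]: the word that carries the pair {i, j} along
   and realizes the permutation r1 r2 ...; letters are expected to be < n.-1. *)
Fixpoint chain i j rs : seq (gen n) :=
  match rs with
  | [::] => [::]
  | x :: rs' => let r := insubd i x in Z r i j :: chain (sr r i) (sr r j) rs'
  end.

Lemma chain_cons i j r rs : chain i j (val r :: rs) = Z r i j :: chain (sr r i) (sr r j) rs.
Proof. by rewrite /= valKd. Qed.

Lemma ord_letter (x : nat) : x < n.-1 -> exists2 r : 'I_n, x = val r & r.+1 < n.
Proof.
move=> ltx; have ltxn : x < n by lia.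
by exists (Ordinal ltxn) => //=; lia.
Qed.

Notation distinct := (all (fun p : 'I_n * 'I_n => p.1 != p.2)).
Notation small := (all (fun x : nat => x < n.-1)).

Lemma E_word_valid S : distinct S -> valid (E_word S).
Proof. by elim: S => //= p S IHS /andP[? ?]; apply: valid_E_cons; auto. Qed.

Lemma distinct_sr r S : distinct S -> distinct (map (map_pair (sr r)) S).
Proof. by rewrite all_map; apply: sub_all => p /= /sr_neq. Qed.

Lemma chain_valid i j rs : i != j -> small rs -> valid (chain i j rs).
Proof.
elim: rs i j => // x rs IHrs i j ij /= /andP[/ord_letter[r -> ltr] rss].
rewrite valKd; apply: valid_Z_cons => //; exact: IHrs (sr_neq _ ij) rss.
Qed.

Hint Resolve E_word_valid chain_valid distinct_sr : gens.

Lemma E_word_comm w i j S : valid w -> i != j -> distinct S ->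
  E i j :: E_word S ++ w ~~ E_word S ++ E i j :: w.
Proof.
move=> vw ij; elim: S => [|p S IHS] /=; first by move=> _; exact: wc_refl.
move=> /andP[p12 dS]; apply: wc_trans (E_comm _ _ _) _; auto with gens.
by apply: wcong_cons; auto with gens.
Qed.

Lemma Z_E_word w r i j S : valid w -> r.+1 < n -> i != j -> distinct S ->
  Z r i j :: E_word S ++ w ~~ E_word (map (map_pair (sr r)) S) ++ Z r i j :: w.
Proof.
move=> vw ltr ij; elim: S => [|p S IHS] /=; first by move=> _; exact: wc_refl.
move=> /andP[p12 dS]; apply: wc_trans (ZE_comm _ _ _ _) _; auto with gens.
by apply: wcong_cons; auto with gens.
Qed.

(* Compute Z_ij Z_(ri,rj) Z_hk in two ways. *)
Lemma EZ_swap w r i j h k : valid w -> r.+1 < n -> i != j -> h != k ->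
  [:: E i j, Z r h k & w] ~~ [:: E h k, Z r i j & w].
Proof.
move=> vw ltr ij hk; have rij := sr_neq r ij.
apply: wc_trans (wc_sym (E_idem _ ij)) _; first by auto with gens.
have := @ZZ (Z r h k :: w) (valid_Z_cons ltr hk vw) r i j _ _ ltr ij rij.
rewrite !srK => /wc_sym/wc_trans; apply.
apply: wc_trans (wcong_cons (Z_valid ltr ij) (ZZ vw ltr rij hk)) _.
apply: wc_trans (ZE_comm _ ltr ij rij) _; first by auto with gens.
rewrite !srK.
apply: wc_trans (wcong_cons (E_valid ij) (ZE_comm vw ltr ij (sr_neq r hk))) _.
rewrite !srK.
apply: wc_trans (E_comm _ ij hk) _; first by auto with gens.
by apply: wcong_cons (EZ_absorb vw ltr ij); exact: E_valid.
Qed.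

(** The letter emits [E i j] on its left, which then crosses to its right. This supplies the leading
    [E] that inductions on the tail require. *)
Lemma EZ_carry w r i j : valid w -> r.+1 < n -> i != j ->
  Z r i j :: w ~~ [:: Z r i j, E (sr r i) (sr r j) & w].
Proof.
move=> vw ltr ij; apply: wc_trans (wc_sym (EZ_absorb vw ltr ij)) _.
exact: EZ_comm.
Qed.

Lemma word_letters_small u : valid u -> small (word_letters u).
Proof.
elim: u => //= -[i j|r i j] u IHu /= /andP[vg /IHu] //= ->.
by case/andP: vg => ltr _; rewrite andbT; lia.
Qed.

Lemma word_edges_distinct u : valid u -> distinct (word_edges u).
Proof.
elim: u => //= g u IHu /andP[vg /IHu dis]; apply/andP; split.
  by case: g vg => [i j|r i j] /=; [|case/andP=> _]; rewrite -val_eqE => /ltn_eqF->.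
by rewrite all_map; apply: sub_all dis => p /=; rewrite (inj_eq perm_inj).
Qed.

Hint Resolve word_letters_small word_edges_distinct : gens.

(** The leading [E i j] lets each letter [Z r h k] take over the pair [i, j], leaving [E h k]
    behind. The tail is normalized with the carried pair, and its e's then move left across
    [Z r i j], which applies [sr r] to their indices. *)
Lemma word_normal_E u i j : valid u -> i != j ->
  E i j :: u ~~ E i j :: E_word (word_edges u) ++ chain i j (word_letters u).
Proof.
elim: u i j => [|g u IHu] i j; first by move=> *; exact: wc_refl.
case: g => [h k|r h k] /andP[vg vu] ij.
  have lthk : h < k := vg; have hk : h != k by rewrite -val_eqE neq_ltn lthk.
  rewrite /= map_pair1 -E_lt //.
  apply: wc_trans (E_comm vu ij hk) _.
  apply: wc_trans (wcong_cons (E_valid hk) (IHu _ _ vu ij)) _.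
  by apply: E_comm => //; auto with gens.
case/andP: vg => ltr lthk.
have hk : h != k by rewrite -val_eqE neq_ltn lthk.
have rij := sr_neq r ij.
rewrite [word_letters _]/= chain_cons [word_edges _]/= -Z_lt // srV.
set S := word_edges u; set C := chain _ _ _.
have dS : distinct S by exact: word_edges_distinct.
have vC : valid C by apply: chain_valid rij (word_letters_small vu).
(* The exchange uses up [E i j]; the new letter [Z r i j] emits it again. *)
apply: wc_trans (EZ_swap vu ltr ij hk) _.
apply: wc_trans (wcong_cons (E_valid hk) (wc_sym (EZ_absorb vu ltr ij))) _.
apply: wc_trans (wc_sym (E_comm _ ij hk)) _; first by auto with gens.
apply: (wcong_cons (E_valid ij)); apply: (wcong_cons (E_valid hk)).
apply: wc_trans (EZ_carry vu ltr ij) _.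
apply: wc_trans (wcong_cons (Z_valid ltr ij) (IHu _ _ vu rij)) _.
apply: wc_trans (wc_sym (EZ_carry _ ltr ij)) _; first by auto with gens.
exact: Z_E_word.
Qed.

Lemma E_gen_pair_absorb g u : valid (g :: u) ->
  E (gen_pair g).1 (gen_pair g).2 :: g :: u ~~ g :: u.
Proof.
case: g => [h k|r h k] /andP[vg vu] /=.
  have lthk : h < k := vg.
  by rewrite -E_lt //; apply: E_idem; rewrite // -val_eqE neq_ltn lthk.
case/andP: vg => ltr lthk.
by rewrite -Z_lt //; apply: EZ_absorb; rewrite // -val_eqE neq_ltn lthk.
Qed.

(** Both e's cross the first letter, the rest of the chain changes its pair by induction, and the
    e's return. Then [EZ_swap] changes the pair of the first letter. *)
Lemma chain_swap i j h k rs : i != j -> h != k -> small rs ->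
  [:: E i j, E h k & chain i j rs] ~~ [:: E i j, E h k & chain h k rs].
Proof.
elim: rs i j h k => [|x rs IHrs] i j h k ij hk; first by move=> _; exact: wc_refl.
case/andP=> /ord_letter[r -> ltr] rss; rewrite !chain_cons.
have rij := sr_neq r ij; have rhk := sr_neq r hk.
set C1 := chain _ _ rs; set C2 := chain (sr r h) _ rs.
have v1 : valid C1 by exact: chain_valid.
have v2 : valid C2 by exact: chain_valid.
have step C : valid C -> [:: E i j, E h k, Z r i j & C] ~~
    [:: Z r i j, E (sr r i) (sr r j), E (sr r h) (sr r k) & C].
  move=> vC; have vE := EZ_comm vC ltr ij hk.
  apply: wc_trans (wcong_cons (E_valid ij) vE) _.
  by apply: EZ_comm; auto with gens.
apply: wc_trans (step _ v1) _.
apply: wc_trans (wcong_cons (Z_valid ltr ij) (IHrs _ _ _ _ rij rhk rss)) _.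
apply: wc_trans (wc_sym (step _ v2)) _.
apply: wc_trans (wcong_cons (E_valid ij) (EZ_swap v2 ltr hk ij)) _.
apply: wc_trans (E_idem _ ij) _; first by auto with gens.
by apply: (wcong_cons (E_valid ij)); apply: wc_sym; exact: EZ_absorb.
Qed.

(** A left context is peeled off by carrying the [E] through its letters, since the chain behind it
    starts with a moved pair. The leading [E] is needed because a squared letter becomes a product
    of e's and not the empty word. *)
Lemma chain_cox rs rs' i j : cox n.-1 rs rs' -> i != j ->
  E i j :: chain i j rs ~~ E i j :: chain i j rs'.
Proof.
move=> rr; elim: rr i j => [u|u v _ IH|u v w _ IH1 _ IH2|a b l r sa sb slr lr] i j ij.
- exact: wc_refl.
- exact/wc_sym/IH.
- exact: wc_trans (IH1 _ _ ij) (IH2 _ _ ij).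
have sl : small l by move: slr; rewrite all_cat => /andP[].
have sr' : small r by move: slr; rewrite all_cat => /andP[].
elim: a sa i j ij => [_|x a IHa /andP[/ord_letter[t -> ltt] sa']] i j ij; last first.
  have sa : small a := sa'.
  rewrite !cat_cons !chain_cons; have tij := sr_neq t ij.
  have carry c : small c -> Z t i j :: chain (sr t i) (sr t j) c ~~
      [:: Z t i j, E (sr t i) (sr t j) & chain (sr t i) (sr t j) c].
    by move=> sc; apply: EZ_carry => //; exact: chain_valid.
  apply: (wcong_cons (E_valid ij)); apply: wc_trans (carry _ _) _.
    by rewrite !all_cat sa sl.
  apply: wc_trans (wcong_cons (Z_valid ltt ij) (IHa sa _ _ tij)) (wc_sym (carry _ _)).
  by rewrite !all_cat sa sr'.
case: lr sl {sr' slr} => [x|x|x y ltxy]; rewrite !cat_cons !cat0s.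
- case/andP=> /ord_letter[t -> ltt] _; rewrite !chain_cons !srK.
  (* The square turns into two copies of [E i j], which merge with the leading one. *)
  apply: wc_trans (wcong_cons (E_valid ij) (ZZ _ ltt ij (sr_neq t ij))) _.
    exact: chain_valid.
  rewrite !srK; have vC := chain_valid ij sb.
  apply: wc_trans (E_idem _ ij) (E_idem vC ij); auto with gens.
- case/and3P=> /ord_letter[t -> ltt] /ord_letter[t' et ltt'] _; rewrite et !chain_cons.
  apply: (wcong_cons (E_valid ij)).
  have dtt : dist t t' = 1%N by rewrite /dist -et /=; lia.
  have bE k : sr t (sr t' (sr t k)) = sr t' (sr t (sr t' k)).
    by have /permP/(_ k) := sr_braid ltt ltt' dtt; rewrite !permM.
  by rewrite !bE; apply: Z_braid => //; apply: chain_valid; auto with gens.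
- case/and3P=> /ord_letter[t ex ltt] /ord_letter[t' ey ltt'] _.
  rewrite ex ey in ltxy *; rewrite !chain_cons; apply: (wcong_cons (E_valid ij)).
  have dtt : 1 < dist t t' by rewrite /dist; simpl in ltxy; lia.
  have fE k : sr t' (sr t k) = sr t (sr t' k).
    by have /permP/(_ k) := sr_far ltt ltt' dtt; rewrite !permM.
  by rewrite !fE; apply: Z_far => //; apply: chain_valid; auto with gens.
Qed.

(** * Products of e's and the equivalence they generate *)

Lemma E_absorb_mem w p S : valid w -> distinct S -> p \in S ->
  E p.1 p.2 :: E_word S ++ w ~~ E_word S ++ w.
Proof.
move=> vw; elim: S => // q S IHS /= /andP[q12 dS]; rewrite inE => /predU1P[->|pS].
  by apply: E_idem; auto with gens.
have p12 := allP dS _ pS.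
apply: wc_trans (E_comm _ p12 q12) _; first by auto with gens.
exact: wcong_cons (E_valid q12) (IHS dS pS).
Qed.

Lemma E_absorb_conn w i j S : valid w -> distinct S -> i != j -> conn S i j ->
  E i j :: E_word S ++ w ~~ E_word S ++ w.
Proof.
move=> vw dS + /connectP[p]; set W := E_word S ++ w.
have vW : valid W by apply: valid_cat; auto with gens.
have edge_absorb x y : edge S x y -> x != y /\ E x y :: W ~~ W.
  case/orP=> xyS; have xy := allP dS _ xyS.
    by split=> //; exact: (E_absorb_mem vw dS xyS).
  by rewrite eq_sym E_sym; split=> //; exact: (E_absorb_mem vw dS xyS).
elim: p i => [|k p IHp] i /=; first by move=> /eqP + _ e; rewrite e.
move=> ij /andP[/edge_absorb[ik Wik] pk] lastj.
have [eqkj|kj] := eqVneq k j; first by rewrite -eqkj.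
have Wkj := IHp _ kj pk lastj.
have ki : k != i by rewrite eq_sym.
(* With [k] the next vertex of the path, [E i k] is inserted, the triangle relation trades [E i j]
   for [E k j], and both [E k j] and [E i k] are absorbed. *)
apply: wc_trans (wcong_cons (E_valid ij) (wc_sym Wik)) _.
apply: wc_trans (E_comm vW ij ik) _; rewrite (E_sym i k).
apply: wc_trans (wc_sym (E_tri vW ki kj ij)) _.
apply: wc_trans (wcong_cons (E_valid ki) Wkj) _.
by rewrite E_sym.
Qed.

Lemma E_word_absorb w S T : valid w -> distinct S -> distinct T ->
  (forall p, p \in T -> conn S p.1 p.2) -> E_word T ++ E_word S ++ w ~~ E_word S ++ w.
Proof.
move=> vw dS; elim: T => [|p T IHT] /=; first by move=> *; exact: wc_refl.
case/andP=> p12 dT TS.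
apply: wc_trans (wcong_cons (E_valid p12) (IHT dT _)) _.
  by move=> q qT; apply: TS; rewrite inE qT orbT.
by apply: E_absorb_conn => //; apply: TS; rewrite inE eqxx.
Qed.

Lemma E_word_catC w S T : valid w -> distinct S -> distinct T ->
  E_word S ++ E_word T ++ w ~~ E_word T ++ E_word S ++ w.
Proof.
move=> vw + dT; elim: S => [|p S IHS] /=; first by move=> *; exact: wc_refl.
case/andP=> p12 dS; apply: wc_trans (wcong_cons (E_valid p12) (IHS dS)) _.
by apply: E_word_comm => //; apply: valid_cat; auto with gens.
Qed.

(** Each product absorbs the other, so both are congruent to their common product. *)
Lemma E_word_conn w S T : valid w -> distinct S -> distinct T ->
  conn S =2 conn T -> E_word S ++ w ~~ E_word T ++ w.
Proof.
move=> vw dS dT ST.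
apply: wc_trans (wc_sym (@E_word_absorb w S T _ _ _ _)) _ => // [p pT|].
  by rewrite ST; exact: conn_mem.
apply: wc_trans (E_word_catC _ _ _) _ => //.
by apply: E_word_absorb => // p pS; rewrite -ST; exact: conn_mem.
Qed.

(** * Completeness of the relations and generation *)

Lemma act_word_letters u i : valid u ->
  act_word (word_letters u) i = word_perm u i.
Proof.
elim: u i => [|g u IHu] i; first by rewrite /word_perm big_nil perm1.
case: g => [h k|r h k] /andP[vg vu]; rewrite /word_perm big_cons permM -/(word_perm u).
  by rewrite /= perm1; exact: IHu.
case/andP: vg => ltr _; rewrite /= -IHu //.
by congr act_word; rewrite -sr_val.
Qed.

(** The first letter supplies the [E] that starts the normalization; its pair occurs in
    [word_edges w], so the product of e's absorbs it afterwards. *)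
Lemma word_normal g u (w := g :: u) (p := gen_pair g) : valid w ->
  w ~~ E_word (word_edges w) ++ chain p.1 p.2 (word_letters w).
Proof.
move=> vw; have dS := word_edges_distinct vw.
have pw : p \in word_edges w by rewrite inE eqxx.
have p12 := allP dS _ pw.
apply: wc_trans (wc_sym (E_gen_pair_absorb vw)) _.
apply: wc_trans (word_normal_E vw p12) _.
by apply: E_absorb_mem => //; apply: chain_valid; auto with gens.
Qed.

Lemma evalw_inj u v : u <> [::] -> v <> [::] -> valid u -> valid v ->
  evalw u = evalw v -> u ~~ v.
Proof.
case: u v => [|g u] // [|h v] // _ _.
set a := g :: u; set b := h :: v => va vb.
rewrite !evalw_edge => /edge_elt_eq[perm_eq conn_eq].
have la := word_letters_small va; have lb := word_letters_small vb.
have da := word_edges_distinct va; have db := word_edges_distinct vb.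
have cox_ab : cox n.-1 (word_letters a) (word_letters b).
  apply: cox_complete => // x; have [ltxn|lenx] := ltnP x n.
    by rewrite -[x]/(val (Ordinal ltxn)) !act_word_letters // perm_eq.
  (* Points from [n] on are fixed by letters below [n.-1]; passing from [n <= x] to [n.-1 < x] takes
     a positive [n]. *)
  have n_gt0 : 0 < n by exact: leq_ltn_trans (leq0n _) (ltn_ord (gen_pair g).1).
  by rewrite !(@act_word_gt n.-1) //; lia.
set p := gen_pair g; set q := gen_pair h.
have pa : p \in word_edges a by rewrite inE eqxx.
have qb : q \in word_edges b by rewrite inE eqxx.
have p12 := allP da _ pa; have q12 := allP db _ qb.
have pb : conn (word_edges b) p.1 p.2 by rewrite -conn_eq; exact: conn_mem.
have vpa := chain_valid p12 la; have vqa := chain_valid q12 la.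
have vqb := chain_valid q12 lb.
(* The two chains carry the pairs [p] and [q]. Both pairs lie in the common equivalence, so both e's
   can be placed before the chain, as [chain_swap] requires. *)
have absorb w : valid w -> E_word (word_edges b) ++ w ~~
    E_word (word_edges b) ++ [:: E p.1 p.2, E q.1 q.2 & w].
  move=> vw; apply: wc_trans (wc_sym (E_absorb_mem vw db qb)) _.
  apply: wc_trans (E_word_comm vw q12 db) _.
  have vqw : valid (E q.1 q.2 :: w) by auto with gens.
  apply: wc_trans (wc_sym (E_absorb_conn vqw db p12 pb)) _.
  exact: E_word_comm.
apply: wc_trans (word_normal va) _; apply: wc_trans _ (wc_sym (word_normal vb)).
apply: wc_trans (E_word_conn vpa da db conn_eq) _.
apply: wc_trans (absorb _ vpa) (wc_trans _ (wc_sym (absorb _ vqb))).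
apply: wcong_catl; first exact: E_word_valid.
apply: wc_trans (chain_swap p12 q12 la) _.
by apply: (wcong_cons (E_valid p12)); exact: chain_cox.
Qed.

Lemma evalw_in_sR u : u <> [::] -> valid u -> in_sR (evalw u).
Proof.
case: u => // g u _ vgu; rewrite evalw_edge.
apply: (@edge_elt_in_sR _ _ _ (gen_pair g)); first by rewrite inE eqxx.
by apply: (allP (word_edges_distinct vgu)); rewrite inE eqxx.
Qed.

(** Pulled back to the top row, every letter of the chain carries the pair [i, j] itself, so a chain
    merges nothing else. *)
Lemma respects_chain f i j rs : f i = f j -> small rs ->
  respects f (word_edges (chain i j rs)).
Proof.
elim: rs i j f => // x rs IHrs i j f fij /andP[/ord_letter[r -> ltr] rss].
rewrite chain_cons word_edges_cons respects_gen gen_pair_Z fij eqxx.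
rewrite respects_map srV; apply: IHrs => //=.
by rewrite !srK.
Qed.

Lemma word_letters_chain i j rs : small rs -> word_letters (chain i j rs) = rs.
Proof.
elim: rs i j => // x rs IHrs i j /andP[/ord_letter[r -> ltr] rss].
by rewrite chain_cons /= IHrs.
Qed.

Lemma word_perm_E_word S : word_perm (E_word S) = 1.
Proof. by rewrite /word_perm big_map big1. Qed.

Lemma respects_E_word f S : respects f (word_edges (E_word S)) = respects f S.
Proof.
elim: S => // p S IHS.
by rewrite word_edges_cons respects_gen gen_pair_E map_pair1 IHS.
Qed.

Lemma evalw_surj x : in_sR x ->
  exists w : seq (gen n), w <> [::] /\ valid w /\ evalw w = x.
Proof.
case/in_sR_edge=> w [[|p S] [-> // _ ltS]].
have dS : distinct (p :: S).
  by apply: sub_all ltS => q ltq; rewrite -val_eqE neq_ltn ltq.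
have p12 : p.1 != p.2 by case/andP: dS.
(* The permutation [w], extended by the identity from [n] on, becomes a function on naturals to
   which [act_word_surj] applies. *)
pose f (y : nat) := if insub y is Some i then val (w i) else y.
have f_val i : f (val i) = val (w i) by rewrite /f valK.
have f_ge y : n <= y -> f y = y by move=> leny; rewrite /f insubN // -leqNgt.
have injf : injective f.
  move=> y z; have [lty|ley] := ltnP y n; have [ltz|lez] := ltnP z n.
  - rewrite -[y]/(val (Ordinal lty)) -[z]/(val (Ordinal ltz)) !f_val.
    by move/val_inj/perm_inj->.
  - rewrite -[y]/(val (Ordinal lty)) f_val f_ge // => eqz.
    by have := ltn_ord (w (Ordinal lty)); rewrite /= in eqz *; lia.
  - rewrite -[z]/(val (Ordinal ltz)) f_val f_ge // => eqy.
    by have := ltn_ord (w (Ordinal ltz)); rewrite /= in eqy *; lia.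
  - by rewrite !f_ge.
have [|rs rss rsf] := @act_word_surj n.-1 f injf; first by move=> y lty; apply: f_ge; lia.
have vc := chain_valid p12 rss.
exists (E_word (p :: S) ++ chain p.1 p.2 rs); split=> //; split.
  by apply: valid_cat; auto with gens.
rewrite evalw_edge; apply/edge_elt_eq; split.
  apply/permP=> i; apply: val_inj.
  rewrite word_perm_cat word_perm_E_word mul1g.
  have := act_word_letters i vc; rewrite word_letters_chain // rsf.
  by rewrite -[nat_of_ord i]/(val i) f_val.
apply: conn_eq => f'; rewrite word_edges_cat respects_cat respects_E_word.
rewrite word_perm_E_word map_pair1.
case: (boolP (respects f' (p :: S))) => //= /andP[/eqP fp _].
exact: respects_chain.
Qed.

End Words.

Theorem theorem5p20 (n : nat) :
  (* generated words land in sR(S_n) *)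
  (forall w : seq (gen n), w <> [::] -> all (@valid_gen n) w -> in_sR (evalw w))
  (* the generators generate sR(S_n) *)
  /\ (forall x : relt n, in_sR x ->
        exists w : seq (gen n), w <> [::] /\ all (@valid_gen n) w /\ evalw w = x)
  (* the kernel of evaluation is the congruence generated by (a)-(d) *)
  /\ (forall u v : seq (gen n), u <> [::] -> v <> [::] ->
        all (@valid_gen n) u -> all (@valid_gen n) v ->
        (evalw u = evalw v <-> wcong u v)).
Proof.
split; first exact: evalw_in_sR.
split=> [x|u v u0 v0 vu vv]; first exact: evalw_surj.
by split; [exact: evalw_inj|exact: wcong_evalw].
Qed.
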